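(* Let $H$ be a Hopf algebra over a field $\mathbf{k}$ and equip $H^*=\mathrm{Hom}_{\mathbf{k}}(H,\mathbf{k})$ with the convolution product. Define a left action of $H^*$ on $H$ by $$f\rhd h=h_1f(h_2)\quad\text{for all } f\in H^*,\ h\in H.$$ Then $H$ is a left $H^*$-module. Let $\chi\in H^*$ and define a map $T:H\to H$ by $T(h)=\chi(h_1)h_2$. Then $(H,T)$ is a generic Rota-Baxter paired $H^*$-module of weight $-1$ if and only if $\chi^2=\chi$ (square taken in the convolution algebra $H^*$).
   Context: Sweedler notation: $\Delta(h)=h_1\otimes h_2$ (summation understood). The convolution product on $H^*$ is $(fg)(h)=f(h_1)g(h_2)$, with unit $\varepsilon$. For an algebra $B$ over $\mathbf{k}$, a left $B$-module $M$ and $\mathbf{k}$-linear maps $P:B\to B$, $T:M\to M$, the triple $(M,P,T)$ is a Rota-Baxter paired $B$-module of weight $\lambda\in\mathbf{k}$ if $$P(b)\cdot T(m)=T(P(b)\cdot m)+T(b\cdot T(m))+\lambda T(b\cdot m)\quad\text{for all } b\in B,\ m\in M.$$ The pair $(M,T)$ is a generic Rota-Baxter paired $B$-module of weight $\lambda$ if $(M,P,T)$ is a Rota-Baxter paired $B$-module of weight $\lambda$ for every $\mathbf{k}$-linear map $P:B\to B$. *)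

(* Defs.v *)
From HB Require Import structures.
From mathcomp Require Import all_boot all_order all_algebra.
From mathcomp Require Import boolp.
From mathcomp Require Import freeg.

Set Implicit Arguments.
Unset Strict Implicit.
Unset Printing Implicit Defensive.

Import GRing.Theory.
Local Open Scope ring_scope.
Local Open Scope quotient_scope.

Notation bilinear_map b := (bilinear_for *:%R *:%R b).

(* Tensor products: U (x) V is the free k-module on U * V divided by the
   k-submodule generated by the four families of bilinearity relators.  *)

Section TensorProduct.
Variables (k : fieldType) (U V : lmodType k).

Definition fgen (x : U) (y : V) : {freeg (U * V)%type / k} :=
  [freeg [:: (1, (x, y))]].

Inductive tensor_null : {freeg (U * V)%type / k} -> Prop :=
| TensorNullDl x x' y : tensor_null (fgen (x + x') y - fgen x y - fgen x' y)
| TensorNullDr x y y' : tensor_null (fgen x (y + y') - fgen x y - fgen x y')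
| TensorNullZl c x y : tensor_null (fgen (c *: x) y - c *: fgen x y)
| TensorNullZr c x y : tensor_null (fgen x (c *: y) - c *: fgen x y)
| TensorNull0 : tensor_null 0
| TensorNullP c D E :
    tensor_null D -> tensor_null E -> tensor_null (c *: D + E).

Definition tensor_nullb : {pred {freeg (U * V)%type / k}} :=
  fun D => `[< tensor_null D >].

Lemma tensor_null_closed : zmod_closed tensor_nullb.
Proof.
split=> [|D E /asboolP hD /asboolP hE]; apply/asboolP; first exact: TensorNull0.
by rewrite addrC -scaleN1r; apply: TensorNullP.
Qed.

HB.instance Definition _ :=
  GRing.isZmodClosed.Build {freeg (U * V)%type / k} tensor_nullb
    tensor_null_closed.

Definition tensor := Quotient.quot tensor_nullb.

HB.instance Definition _ := GRing.Zmodule.on tensor.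

Definition tensor_pi (D : {freeg (U * V)%type / k}) : tensor := \pi_tensor D.

Lemma tensor_piP D E : tensor_pi D = tensor_pi E <-> tensor_null (D - E).
Proof.
rewrite /tensor_pi; split.
  by move/eqP; rewrite -Quotient.idealrBE => /asboolP.
by move=> h; apply/eqP; rewrite -Quotient.idealrBE; apply/asboolP.
Qed.

Lemma tensor_piB : {morph tensor_pi : D E / D - E}.
Proof. exact: raddfB (\pi_tensor : {additive _ -> _}). Qed.

Lemma tensor_piD : {morph tensor_pi : D E / D + E}.
Proof. exact: raddfD (\pi_tensor : {additive _ -> _}). Qed.

Lemma tensor_pi0 : tensor_pi 0 = 0.
Proof. exact: raddf0 (\pi_tensor : {additive _ -> _}). Qed.

Lemma tensor_piK (t : tensor) : tensor_pi (repr t) = t.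
Proof. exact: reprK. Qed.

Definition tensor_scale c (t : tensor) : tensor := tensor_pi (c *: repr t).

Lemma tensor_scale_pi c D : tensor_scale c (tensor_pi D) = tensor_pi (c *: D).
Proof.
apply/tensor_piP; rewrite -scalerBr -[_ *: _]addr0.
by apply: TensorNullP TensorNull0; apply/tensor_piP; rewrite tensor_piK.
Qed.

Lemma tensor_scaleA a b t :
  tensor_scale a (tensor_scale b t) = tensor_scale (a * b) t.
Proof. by rewrite -(tensor_piK t) !tensor_scale_pi scalerA. Qed.

Lemma tensor_scale1 : left_id 1 tensor_scale.
Proof. by move=> t; rewrite -(tensor_piK t) !tensor_scale_pi scale1r. Qed.

Lemma tensor_scaleDr : right_distributive tensor_scale +%R.
Proof.
move=> c t u; rewrite -(tensor_piK t) -(tensor_piK u).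
by rewrite -tensor_piD !tensor_scale_pi scalerDr tensor_piD.
Qed.

Lemma tensor_scaleDl t : {morph tensor_scale^~ t : a b / a + b}.
Proof.
move=> a b; rewrite -(tensor_piK t).
by rewrite !tensor_scale_pi scalerDl tensor_piD.
Qed.

HB.instance Definition _ := GRing.Zmodule_isLmodule.Build k tensor
  tensor_scaleA tensor_scale1 tensor_scaleDr tensor_scaleDl.

Lemma tensor_piZ c D : tensor_pi (c *: D) = c *: tensor_pi D.
Proof. by rewrite -tensor_scale_pi. Qed.

Definition tens (x : U) (y : V) : tensor := tensor_pi (fgen x y).

Lemma tens_bilinear : bilinear_map tens.
Proof.
split=> [y c x x'|x c y y']; rewrite /tens /=.
  have <- : tensor_pi (fgen (c *: x) y) = c *: tensor_pi (fgen x y).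
    by rewrite -tensor_piZ; apply/tensor_piP/TensorNullZl.
  by rewrite -tensor_piD; apply/tensor_piP; rewrite opprD addrA; exact: TensorNullDl.
have <- : tensor_pi (fgen x (c *: y)) = c *: tensor_pi (fgen x y).
  by rewrite -tensor_piZ; apply/tensor_piP/TensorNullZr.
by rewrite -tensor_piD; apply/tensor_piP; rewrite opprD addrA; exact: TensorNullDr.
Qed.

Section Lift.
Variables (W : lmodType k) (b : U -> V -> W).

(* The linear map U (x) V -> W induced by b; meaningful for bilinear b only. *)
Definition tensor_lift (t : tensor) : W :=
  fglift (fun xy => b xy.1 xy.2) (repr t).

Hypothesis b_bilin : bilinear_map b.

Let L : {freeg (U * V)%type / k} -> W := fglift (fun xy => b xy.1 xy.2).

Let LB : {morph L : D E / D - E}.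
Proof. exact: lift_is_additive. Qed.

Let L0 : L 0 = 0.
Proof. by rewrite -(subrr 0) LB subrr. Qed.

Let LD : {morph L : D E / D + E}.
Proof. by move=> D E; rewrite -[E in LHS]opprK -[- E]add0r !LB L0 add0r opprK. Qed.

Let LU a z : L [freeg [:: (a, z)]] = a *: b z.1 z.2.
Proof. exact: liftU. Qed.

Let LZ c : {morph L : D / c *: D}.
Proof.
move=> D; rewrite -[D in LHS]freeg_sumE -[D in RHS]freeg_sumE.
have Lsum s (F : U * V -> {freeg (U * V)%type / k}) :
  L (\sum_(z <- s) F z) = \sum_(z <- s) L (F z) by exact: (big_morph L LD L0).
rewrite scaler_sumr !Lsum scaler_sumr; apply: eq_bigr => z _.
rewrite LU scalerA -LU; congr (L _).
by apply/eqP/freeg_eqP => y; rewrite coeffZ !coeffU mulrA.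
Qed.

Let Lgen x y : L (fgen x y) = b x y.
Proof. by rewrite LU scale1r. Qed.

Let Lnull D : tensor_null D -> L D = 0.
Proof.
have [bl br] := b_bilin.
have blD y x x' : b (x + x') y = b x y + b x' y.
  by have := bl y 1 x x'; rewrite /= !scale1r.
have brD x y y' : b x (y + y') = b x y + b x y'.
  by have := br x 1 y y'; rewrite /= !scale1r.
have bl0 y : b 0 y = 0 by apply: (addIr (b 0 y)); rewrite -blD !add0r.
have br0 x : b x 0 = 0 by apply: (addIr (b x 0)); rewrite -brD !add0r.
elim=> [x x' y|x y y'|c x y|c x y||c D' E' _ hD _ hE] //.
- by rewrite !LB !Lgen blD addrAC addrK subrr.
- by rewrite !LB !Lgen brD addrAC addrK subrr.
- by have := bl y c x 0; rewrite /= !addr0 bl0 addr0 LB LZ !Lgen => ->; rewrite subrr.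
- by have := br x c y 0; rewrite /= !addr0 br0 addr0 LB LZ !Lgen => ->; rewrite subrr.
- by rewrite LD LZ hD hE scaler0 addr0.
Qed.

Let lift_pi D : tensor_lift (tensor_pi D) = L D.
Proof.
apply/eqP; rewrite -subr_eq0; apply/eqP.
rewrite -[LHS]LB; apply: Lnull; apply/tensor_piP.
exact: tensor_piK.
Qed.

Lemma tensor_lift_linear : linear tensor_lift.
Proof.
move=> c t u; rewrite -(tensor_piK t) -(tensor_piK u).
by rewrite -tensor_piZ -tensor_piD !lift_pi LD LZ.
Qed.

Lemma tensor_lift_tens x y : tensor_lift (tens x y) = b x y.
Proof. by rewrite lift_pi Lgen. Qed.

End Lift.

Lemma tensor_ind (P : tensor -> Prop) :
    (forall x y, P (tens x y)) ->
    (forall c t u, P t -> P u -> P (c *: t + u)) ->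
  forall t, P t.
Proof.
move=> Pg Pl t; rewrite -(tensor_piK t) -[repr t]freeg_sumE; set D := repr t.
have P0 : P 0.
  by rewrite -(subrr (tens 0 0)) addrC -scaleN1r; apply: Pl.
elim: (dom D) => [|[x y] s ih]; first by rewrite big_nil tensor_pi0.
rewrite big_cons tensor_piD.
set c := coeff _ _.
have -> : [freeg [:: (c, (x, y))]] = c *: fgen x y.
  by apply/eqP/freeg_eqP => z; rewrite coeffZ !coeffU mul1r.
by rewrite tensor_piZ; apply: Pl => //; exact: Pg.
Qed.

Lemma tensor_lin_ext (W : lmodType k) (f g : tensor -> W) :
  linear f -> linear g -> (forall x y, f (tens x y) = g (tens x y)) -> f =1 g.
Proof.
by move=> fl gl fg; apply: tensor_ind => // c t u ht hu; rewrite fl gl ht hu.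
Qed.

End TensorProduct.

(* The ring A (x) B, with (a (x) b) (a' (x) b') = a a' (x) b b'.  A pzRing
   structure is enough to say that a comultiplication is multiplicative. *)

Section TensorMaps.
Variables (k : fieldType).

Definition tensor_map (U U' V V' : lmodType k) (f : U -> U') (g : V -> V') :
    tensor U V -> tensor U' V' :=
  tensor_lift (fun x y => tens (f x) (g y)).

Definition tensor_assoc (U V W : lmodType k) :
    tensor (tensor U V) W -> tensor U (tensor V W) :=
  tensor_lift (fun t z => tensor_lift (fun x y => tens x (tens y z)) t).

Lemma tensPl (U V : lmodType k) c (x x' : U) (y : V) :
  tens (c *: x + x') y = c *: tens x y + tens x' y.
Proof. exact: (tens_bilinear U V).1. Qed.

Lemma tensPr (U V : lmodType k) c (x : U) (y y' : V) :
  tens x (c *: y + y') = c *: tens x y + tens x y'.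
Proof. exact: (tens_bilinear U V).2. Qed.

Lemma tensor_lift_param (U V W X : lmodType k) (b : X -> U -> V -> W) :
    (forall p, bilinear_map (b p)) ->
    (forall c p q x y, b (c *: p + q) x y = c *: b p x y + b q x y) ->
  forall t, linear (fun p => tensor_lift (b p) t).
Proof.
move=> bb bp t c p q; elim/tensor_ind: t => [x y|a t u ht hu].
  by rewrite !tensor_lift_tens.
rewrite !(tensor_lift_linear (bb _)) ht hu !scalerDr !scalerA mulrC.
by rewrite addrACA.
Qed.

Lemma eq_tensor_lift (U V W : lmodType k) (b b' : U -> V -> W) :
  (forall x y, b x y = b' x y) -> forall t, tensor_lift b t = tensor_lift b' t.
Proof.
by move=> bb' t; congr (tensor_lift _ t); apply/funext => x; apply/funext => y.
Qed.

Lemma tensor_lift_comp (U V W X : lmodType k) (f : W -> X) (b : U -> V -> W) :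
    linear f -> bilinear_map b -> forall t,
  f (tensor_lift b t) = tensor_lift (fun x y => f (b x y)) t.
Proof.
move=> fl [bl br].
have bb : bilinear_map (fun x y => f (b x y)).
  split=> [y c x x'|x c y y'] /=; rewrite -fl; congr (f _); first exact: bl.
  exact: br.
elim/tensor_ind => [x y|c t u ht hu]; first by rewrite !tensor_lift_tens.
by rewrite (tensor_lift_linear bb) tensor_lift_linear // fl ht hu.
Qed.

Lemma tensor_map_bilinear (U U' V V' : lmodType k) (f : U -> U') (g : V -> V') :
  linear f -> linear g -> bilinear_map (fun x y => tens (f x) (g y)).
Proof.
move=> fl gl.
by split=> [y c x x'|x c y y'] /=; rewrite ?fl ?gl ?tensPl ?tensPr.
Qed.

Lemma tensor_lift_map (U U' V V' W : lmodType k) (f : U -> U') (g : V -> V')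
    (b : U' -> V' -> W) :
    linear f -> linear g -> bilinear_map b -> forall t,
  tensor_lift b (tensor_map f g t) = tensor_lift (fun x y => b (f x) (g y)) t.
Proof.
move=> fl gl bb t; rewrite /tensor_map (tensor_lift_comp (tensor_lift_linear bb)).
  by apply: eq_tensor_lift => x y; rewrite tensor_lift_tens.
exact: tensor_map_bilinear.
Qed.

Lemma tensor_liftD (U V W : lmodType k) (b b' : U -> V -> W) :
    bilinear_map b -> bilinear_map b' -> forall t,
  tensor_lift (fun x y => b x y + b' x y) t = tensor_lift b t + tensor_lift b' t.
Proof.
move=> bb bb'.
have sb : bilinear_map (fun x y => b x y + b' x y).
  have [[bl br] [bl' br']] := (bb, bb').
  split=> [y c x x'|x c y y'] /=.
    by rewrite [b _ _](bl y) [b' _ _](bl' y) scalerDr addrACA.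
  by rewrite [b _ _](br x) [b' _ _](br' x) scalerDr addrACA.
elim/tensor_ind => [x y|c t u ht hu]; first by rewrite !tensor_lift_tens.
by rewrite !tensor_lift_linear // ht hu scalerDr addrACA.
Qed.

Lemma tensor_assoc_bilinear (U V W : lmodType k) : bilinear_map
  (fun (t : tensor U V) (z : W) => tensor_lift (fun x y => tens x (tens y z)) t).
Proof.
have tb (z : W) : bilinear_map (fun (x : U) (y : V) => tens x (tens y z)).
  by split=> [y c x x'|x c y y'] /=; rewrite ?tensPl ?tensPr.
split=> [z c t t'|t c z z'] /=; first exact: (tensor_lift_linear (tb z)).
apply: (tensor_lift_param (b := fun z x y => tens x (tens y z))) => // d p q x y.
by rewrite !tensPr.
Qed.

Lemma tensor_assoc_linear (U V W : lmodType k) : linear (@tensor_assoc U V W).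
Proof. exact: tensor_lift_linear (tensor_assoc_bilinear U V W). Qed.

Lemma tensor_assoc_tens (U V W : lmodType k) (x : U) (y : V) (z : W) :
  tensor_assoc (tens (tens x y) z) = tens x (tens y z).
Proof.
rewrite /tensor_assoc tensor_lift_tens; last exact: tensor_assoc_bilinear.
rewrite tensor_lift_tens //.
by split=> [v c u u'|u c v v'] /=; rewrite ?tensPl ?tensPr.
Qed.

Lemma tensor_assoc_ext (U V W X : lmodType k)
    (F : tensor U (tensor V W) -> X) (G : tensor (tensor U V) W -> X) :
    linear F -> linear G ->
    (forall x y z, F (tens x (tens y z)) = G (tens (tens x y) z)) ->
  forall t, F (tensor_assoc t) = G t.
Proof.
move=> FL GL FG; elim/tensor_ind => [t z|c t t' ht ht']; last first.
  rewrite (@tensor_assoc_linear U V W) FL GL.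
  by rewrite ht ht'.
elim/tensor_ind: t => [x y|c t t' ht ht']; last first.
  rewrite tensPl; rewrite (@tensor_assoc_linear U V W) FL GL.
  by rewrite ht ht'.
by rewrite tensor_assoc_tens.
Qed.

End TensorMaps.

Section TensorAlgebra.
Variables (k : fieldType) (A B : algType k).
Local Notation AB := (tensor A B).

Definition tensor_mul (s t : AB) : AB :=
  tensor_lift (fun a b => tensor_lift (fun a' b' => tens (a * a') (b * b')) t) s.

Let mul_pure_bilinear a b :
  bilinear_map (fun a' b' => tens (a * a') (b * b') : AB).
Proof.
by split=> [y c x x'|x c y y'] /=; rewrite mulrDr -scalerAr ?tensPl ?tensPr.
Qed.

Let mul_bilinear (t : AB) :
  bilinear_map
    (fun a b => tensor_lift (fun a' b' => tens (a * a') (b * b') : AB) t).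
Proof.
split=> [y c x x'|x c y y'] /=.
  apply: (tensor_lift_param (b := fun a a' b' => tens (a * a') (y * b'))) => //.
  by move=> d p q u v; rewrite mulrDl -scalerAl tensPl.
apply: (tensor_lift_param (b := fun b a' b' => tens (x * a') (b * b'))) => //.
by move=> d p q u v; rewrite mulrDl -scalerAl tensPr.
Qed.

Lemma tensor_mulPl c (s s' t : AB) :
  tensor_mul (c *: s + s') t = c *: tensor_mul s t + tensor_mul s' t.
Proof. exact: tensor_lift_linear. Qed.

Lemma tensor_mulPr c (s t t' : AB) :
  tensor_mul s (c *: t + t') = c *: tensor_mul s t + tensor_mul s t'.
Proof.
apply: (tensor_lift_param (b := fun t a b =>
  tensor_lift (fun a' b' => tens (a * a') (b * b')) t)) => // d p q x y.
exact: tensor_lift_linear.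
Qed.

Lemma tensor_mul_tens a b a' b' :
  tensor_mul (tens a b) (tens a' b') = tens (a * a') (b * b').
Proof. by rewrite /tensor_mul !tensor_lift_tens. Qed.

Lemma tensor_mulA : associative tensor_mul.
Proof.
move=> s t u.
elim/tensor_ind: s => [a b|c s s' h h']; last by rewrite !tensor_mulPl h h'.
elim/tensor_ind: t => [a' b'|c t t' h h'].
  elim/tensor_ind: u => [a'' b''|c u u' h h'].
    by rewrite !tensor_mul_tens !mulrA.
  by rewrite !tensor_mulPr h h'.
by rewrite !(tensor_mulPl, tensor_mulPr) h h'.
Qed.

Lemma tensor_mul1l : left_id (tens 1 1) tensor_mul.
Proof.
elim/tensor_ind => [a b|c t t' h h']; first by rewrite tensor_mul_tens !mul1r.
by rewrite tensor_mulPr h h'.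
Qed.

Lemma tensor_mul1r : right_id (tens 1 1) tensor_mul.
Proof.
elim/tensor_ind => [a b|c t t' h h']; first by rewrite tensor_mul_tens !mulr1.
by rewrite tensor_mulPl h h'.
Qed.

Lemma tensor_mulDl : left_distributive tensor_mul +%R.
Proof. by move=> s t u; rewrite -[s]scale1r tensor_mulPl !scale1r. Qed.

Lemma tensor_mulDr : right_distributive tensor_mul +%R.
Proof. by move=> s t u; rewrite -[t]scale1r tensor_mulPr !scale1r. Qed.

HB.instance Definition _ := GRing.Zmodule_isPzRing.Build AB
  tensor_mulA tensor_mul1l tensor_mul1r tensor_mulDl tensor_mulDr.

End TensorAlgebra.

HB.mixin Record Algebra_isHopf (k : fieldType) H of GRing.Algebra k H := {
  comul : {linear H -> tensor H H};
  counit : {scalar H};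
  antipode : {linear H -> H};
  comulA : forall h : H,
    tensor_assoc (tensor_map comul id (comul h)) = tensor_map id comul (comul h);
  counit_comul : forall h : H,
    tensor_lift (fun x y => counit x *: y) (comul h) = h;
  comul_counit : forall h : H,
    tensor_lift (fun x y => counit y *: x) (comul h) = h;
  comul_monoid_morphism : monoid_morphism comul;
  counit_monoid_morphism : monoid_morphism counit;
  antipode_comul : forall h : H,
    tensor_lift (fun x y => antipode x * y) (comul h) = (counit h)%:A;
  comul_antipode : forall h : H,
    tensor_lift (fun x y => x * antipode y) (comul h) = (counit h)%:A
}.

#[short(type="hopfType")]
HB.structure Definition Hopf (k : fieldType) :=
  {H of GRing.Algebra k H & Algebra_isHopf k H}.

(* Sweedler notation: E is the value at h_1 (x) h_2 of an expression bilinear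
   in the two bound variables. *)
Notation "[ 'sw' x , y <- h => E ]" :=
  (tensor_lift (fun x y => E) (comul h))
  (at level 0, x name, y name, h at level 99, E at level 200,
   format "[ 'sw'  x ,  y  <-  h  =>  E ]") : ring_scope.

(* H^* = Hom_k(H, k); for a Hopf algebra H it is made an algebra below, with
   the convolution product. *)
Section DualSpace.
Variables (k : fieldType) (H : lmodType k).

Definition dual_space := {scalar H}.

HB.instance Definition _ := gen_eqMixin dual_space.
HB.instance Definition _ := gen_choiceMixin dual_space.

Lemma dualP (f g : dual_space) : (forall h, f h = g h) -> f = g.
Proof.
move=> fg; have {fg} fg : f = g :> (H -> k) by apply/funext.
case: f g fg => [f [[f1] [f2]]] [g [[g1] [g2]]] /= fg.
by subst g; congr (GRing.Linear.Pack (GRing.Linear.Class _ _));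
   [congr GRing.isNmodMorphism.Axioms_ | congr GRing.isScalable.Axioms_].
Qed.

Implicit Types f g : dual_space.

Definition dual_zero : dual_space := (\0 : {scalar H}).
Definition dual_add f g : dual_space := (f \+ g : {scalar H}).
Definition dual_opp f : dual_space := (\- f : {scalar H}).

Lemma dual_addA : associative dual_add.
Proof. by move=> f g u; apply: dualP => h /=; rewrite addrA. Qed.
Lemma dual_addC : commutative dual_add.
Proof. by move=> f g; apply: dualP => h /=; rewrite addrC. Qed.
Lemma dual_add0 : left_id dual_zero dual_add.
Proof. by move=> f; apply: dualP => h /=; rewrite add0r. Qed.
Lemma dual_addN : left_inverse dual_zero dual_opp dual_add.
Proof. by move=> f; apply: dualP => h /=; rewrite addNr. Qed.

HB.instance Definition _ := GRing.isZmodule.Build dual_space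
  dual_addA dual_addC dual_add0 dual_addN.

Definition dual_scale_fun (c : k) f (h : H) : k := c * f h.

Lemma dual_scale_linear (c : k) f : scalar (dual_scale_fun c f).
Proof. by move=> a x y; rewrite /dual_scale_fun scalarP mulrDr [c * _]mulrCA. Qed.

HB.instance Definition _ (c : k) f :=
  GRing.isLinear.Build k H k *%R (dual_scale_fun c f) (dual_scale_linear c f).

Definition dual_scale (c : k) f : dual_space :=
  (dual_scale_fun c f : {scalar H}).

Lemma dual_scaleA a b f : dual_scale a (dual_scale b f) = dual_scale (a * b) f.
Proof. by apply: dualP => h; rewrite /= /dual_scale_fun mulrA. Qed.
Lemma dual_scale1 : left_id 1 dual_scale.
Proof. by move=> f; apply: dualP => h; rewrite /= /dual_scale_fun mul1r. Qed.
Lemma dual_scaleDr : right_distributive dual_scale +%R.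
Proof. by move=> c f g; apply: dualP => h; rewrite /= /dual_scale_fun mulrDr. Qed.
Lemma dual_scaleDl f : {morph dual_scale^~ f : a b / a + b}.
Proof. by move=> a b; apply: dualP => h; rewrite /= /dual_scale_fun mulrDl. Qed.

HB.instance Definition _ := GRing.Zmodule_isLmodule.Build k dual_space
  dual_scaleA dual_scale1 dual_scaleDr dual_scaleDl.

Lemma dualDE f g h : (f + g) h = f h + g h. Proof. by []. Qed.
Lemma dualZE (c : k) f h : (c *: f) h = c * f h. Proof. by []. Qed.

End DualSpace.

Section ScaleBilinear.
Variables (k : fieldType) (H V : lmodType k) (f : dual_space H).

Lemma scalel_bilinear : bilinear_map (fun (x : H) (y : V) => f x *: y).
Proof.
split=> [y c x x'|x c y y'] /=; first by rewrite scalarP scalerDl -scalerA.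
by rewrite scalerDr !scalerA mulrC.
Qed.

Lemma scaler_bilinear : bilinear_map (fun (x : V) (y : H) => f y *: x).
Proof.
split=> [y c x x'|x c y y'] /=; last by rewrite scalarP scalerDl -scalerA.
by rewrite scalerDr !scalerA mulrC.
Qed.

End ScaleBilinear.

Section Convolution.
Variables (k : fieldType) (H : hopfType k).
Implicit Types f g : dual_space H.

Definition conv_fun f g (h : H) : k := [sw h1, h2 <- h => f h1 * g h2 : k^o].

Lemma conv_bilinear f g : bilinear_map (fun x y : H => f x * g y : k^o).
Proof.
split=> [y c x x'|x c y y'] /=; rewrite scalarP.
  by rewrite mulrDl -mulrA.
by rewrite mulrDr mulrCA.
Qed.

Lemma conv_linear f g : scalar (conv_fun f g).
Proof.
by move=> c x y; rewrite /conv_fun linearP (tensor_lift_linear (conv_bilinear f g)).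
Qed.

HB.instance Definition _ f g :=
  GRing.isLinear.Build k H k *%R (conv_fun f g) (conv_linear f g).

Definition conv f g : dual_space H := (conv_fun f g : {scalar H}).
Definition conv1 : dual_space H := counit.

Lemma conv1l : left_id conv1 conv.
Proof.
move=> f; apply: dualP => h; rewrite -{2}(counit_comul h) /= /conv_fun.
rewrite (tensor_lift_comp (X := k^o) (scalarP f) (scalel_bilinear _ _)).
by apply: (eq_tensor_lift (W := k^o)) => x y; rewrite scalarZ.
Qed.

Lemma conv1r : right_id conv1 conv.
Proof.
move=> f; apply: dualP => h; rewrite -{2}(comul_counit h) /= /conv_fun.
rewrite (tensor_lift_comp (X := k^o) (scalarP f) (scaler_bilinear _ _)).
by apply: (eq_tensor_lift (W := k^o)) => x y; rewrite scalarZ mulrC.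
Qed.

Lemma convA : associative conv.
Proof.
move=> f g u; apply: dualP => h; rewrite /= /conv_fun.
pose F := tensor_lift (fun x t => f x * tensor_lift (fun x y => g x * u y : k^o) t : k^o).
pose G := tensor_lift (fun t y => tensor_lift (fun x y => f x * g y : k^o) t * u y : k^o).
have Fb : bilinear_map
    (fun x t => f x * tensor_lift (fun x y => g x * u y : k^o) t : k^o).
  split=> [y c x x'|x c y y'] /=; first by rewrite scalarP mulrDl -mulrA.
  by rewrite (tensor_lift_linear (conv_bilinear g u)) mulrDr mulrCA.
have Gb : bilinear_map
    (fun t y => tensor_lift (fun x y => f x * g y : k^o) t * u y : k^o).
  split=> [y c x x'|x c y y'] /=; last by rewrite scalarP mulrDr mulrCA.
  by rewrite (tensor_lift_linear (conv_bilinear f g)) mulrDl -mulrA.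
have FL : linear F by exact: tensor_lift_linear Fb.
have GL : linear G by exact: tensor_lift_linear Gb.
transitivity (F (tensor_map id comul (comul h))).
  by rewrite /F tensor_lift_map //; exact: linearP.
rewrite -comulA; transitivity (G (tensor_map comul id (comul h))); last first.
  by rewrite /G tensor_lift_map //; exact: linearP.
apply: (tensor_assoc_ext (X := k^o)) => // x y z.
by rewrite /F /G !tensor_lift_tens ?mulrA //; exact: conv_bilinear.
Qed.

Lemma convDl : left_distributive conv +%R.
Proof.
move=> f g u; apply: dualP => h; rewrite dualDE /= /conv_fun.
rewrite -(tensor_liftD (conv_bilinear _ _) (conv_bilinear _ _)).
by apply: (eq_tensor_lift (W := k^o)) => x y; rewrite dualDE mulrDl.
Qed.

Lemma convDr : right_distributive conv +%R.
Proof.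
move=> f g u; apply: dualP => h; rewrite dualDE /= /conv_fun.
rewrite -(tensor_liftD (conv_bilinear _ _) (conv_bilinear _ _)).
by apply: (eq_tensor_lift (W := k^o)) => x y; rewrite dualDE mulrDr.
Qed.

Lemma conv1_neq0 : conv1 != 0.
Proof.
apply/eqP => /(congr1 (fun f : dual_space H => f 1)).
rewrite /conv1 (counit_monoid_morphism (s := H)).1 => /eqP.
by rewrite oner_eq0.
Qed.

HB.instance Definition _ := GRing.Zmodule_isNzRing.Build (dual_space H)
  convA conv1l conv1r convDl convDr conv1_neq0.

Lemma conv_scaleAl (c : k) f g : c *: (f * g) = (c *: f) * g.
Proof.
apply: dualP => h; rewrite dualZE /= /conv_fun.
rewrite (tensor_lift_comp (f := fun x : k^o => c * x : k^o)).
- by apply: (eq_tensor_lift (W := k^o)) => x y; rewrite dualZE mulrA.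
- by move=> a x y; rewrite mulrDr mulrCA.
- exact: conv_bilinear.
Qed.

HB.instance Definition _ :=
  GRing.Lmodule_isLalgebra.Build k (dual_space H) conv_scaleAl.

Lemma conv_scaleAr (c : k) f g : c *: (f * g) = f * (c *: g).
Proof.
apply: dualP => h; rewrite dualZE /= /conv_fun.
rewrite (tensor_lift_comp (f := fun x : k^o => c * x : k^o)).
- by apply: (eq_tensor_lift (W := k^o)) => x y; rewrite dualZE mulrCA.
- by move=> a x y; rewrite mulrDr mulrCA.
- exact: conv_bilinear.
Qed.

HB.instance Definition _ :=
  GRing.Lalgebra_isAlgebra.Build k (dual_space H) conv_scaleAr.

Lemma convE f g h : (f * g) h = [sw h1, h2 <- h => f h1 * g h2 : k^o].
Proof. by []. Qed.

Lemma conv1E h : (1 : dual_space H) h = counit h.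
Proof. by []. Qed.

End Convolution.

Section RotaBaxterPaired.
Variables (k : fieldType) (B : algType k) (M : lmodType k).

(* act is a left B-module structure on M inducing the given k-linear one. *)
Definition is_left_module (act : B -> M -> M) : Prop :=
  [/\ bilinear_map act,
      forall m, act 1 m = m &
      forall a b m, act (a * b) m = act a (act b m)].

Definition rota_baxter_paired (act : B -> M -> M) (lambda : k)
    (P : {linear B -> B}) (T : {linear M -> M}) : Prop :=
  is_left_module act /\
  forall b m, act (P b) (T m) =
    T (act (P b) m) + T (act b (T m)) + lambda *: T (act b m).

Definition generic_rota_baxter_paired (act : B -> M -> M) (lambda : k)
    (T : {linear M -> M}) : Prop :=
  forall P : {linear B -> B}, rota_baxter_paired act lambda P T.

End RotaBaxterPaired.

Section HopfOperators.
Variables (k : fieldType) (H : hopfType k).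

Definition dual_act (f : dual_space H) (h : H) : H :=
  [sw h1, h2 <- h => f h2 *: h1].

Definition dual_op (chi : dual_space H) (h : H) : H :=
  [sw h1, h2 <- h => chi h1 *: h2].

Lemma dual_op_bilinear (chi : dual_space H) :
  bilinear_map (fun x y : H => chi x *: y).
Proof. exact: scalel_bilinear. Qed.

Lemma dual_op_linear (chi : dual_space H) : linear (dual_op chi).
Proof.
move=> c x y; rewrite /dual_op linearP.
exact: (tensor_lift_linear (dual_op_bilinear chi)).
Qed.

HB.instance Definition _ (chi : dual_space H) :=
  GRing.isLinear.Build k H H *:%R (dual_op chi) (dual_op_linear chi).

End HopfOperators.

(* Main.v *)
Require Import Defs.
From mathcomp Require Import all_boot all_order all_algebra.

Import GRing.Theory.
Local Open Scope ring_scope.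

(** The operators [T_chi = dual_op chi] satisfy [T_chi T_psi = T_(psi chi)], and
    by coassociativity they commute with the action of [H^*].  With weight [-1]
    the Rota-Baxter identity therefore reduces, for any [P], to
    [b . T_(chi^2) m = b . T_chi m], and [chi] is recovered from [T_chi] as
    [counit \o T_chi]. *)

(** Coassociativity in the form $h_{11}\otimes h_{12}\otimes h_2=h_1\otimes h_{21}\otimes h_{22}$,
    tested on a trilinear [b]; it justifies writing $h_1\otimes h_2\otimes h_3$ below. *)
Lemma sweedlerA (k : fieldType) (H : hopfType k) (W : lmodType k)
    (b : H -> H -> H -> W) (h : H) :
    (forall x, bilinear_map (b x)) -> (forall y z, linear (fun x => b x y z)) ->
  [sw t, z <- h => [sw x, y <- t => b x y z]] =
  [sw x, t <- h => [sw y, z <- t => b x y z]].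
Proof.
move=> bb bl.
have bl12 z : bilinear_map (fun x y => b x y z).
  by split=> [y|x]; [exact: bl | exact: (bb x).1].
pose F := fun x t => tensor_lift (b x) t.
pose G := fun t z => tensor_lift (fun x y => b x y z) t.
have Fb : bilinear_map F.
  split=> [t c x x'|x]; last exact: tensor_lift_linear.
  by apply: (tensor_lift_param (b := b)) => // d p q x1 y1; exact: bl.
have Gb : bilinear_map G.
  split=> [z|t c z z']; first exact: tensor_lift_linear.
  apply: (tensor_lift_param (b := fun z x y => b x y z)) => // d p q x y.
  exact: (bb x).2.
transitivity (tensor_lift G (tensor_map comul id (comul h))).
  by rewrite tensor_lift_map //; exact: linearP.
transitivity (tensor_lift F (tensor_map id comul (comul h))); last first.
  by rewrite tensor_lift_map //; exact: linearP.
(* Both sides are now evaluated at the same tensor up to [tensor_assoc], so pure tensors suffice;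
   there both lifts give [b x y z]. *)
rewrite -comulA; apply/esym/tensor_assoc_ext => [||x y z].
- exact: tensor_lift_linear.
- exact: tensor_lift_linear.
- by rewrite !tensor_lift_tens // /F /G !tensor_lift_tens.
Qed.

Section DualOperators.
Variables (k : fieldType) (H : hopfType k).
Implicit Types f g chi psi : dual_space H.

Lemma dual_act_linear f : linear (dual_act f).
Proof.
move=> c x y; rewrite /dual_act linearP.
exact: (tensor_lift_linear (scaler_bilinear _ _)).
Qed.

Lemma scale_linear (V : lmodType k) (c : k) : linear (fun v : V => c *: v).
Proof. by move=> a x y; rewrite scalerDr !scalerA mulrC. Qed.

Lemma scalel_linear (V : lmodType k) (v : V) : linear (fun c : k^o => c *: v).
Proof. by move=> a x y; rewrite scalerDl scalerA. Qed.

(** This lemma and the next four push scalars and linear maps under a Sweedler sum, turning iterated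
    operators into the nested sums that [sweedlerA] handles. *)
Lemma scale_dual_act c f h :
  c *: dual_act f h = [sw x, y <- h => (c * f y) *: x].
Proof.
rewrite (tensor_lift_comp (scale_linear H c) (scaler_bilinear _ _)).
by apply: eq_tensor_lift => x y; rewrite scalerA.
Qed.

Lemma scale_dual_op c chi h :
  c *: dual_op chi h = [sw x, y <- h => (c * chi x) *: y].
Proof.
rewrite (tensor_lift_comp (scale_linear H c) (scalel_bilinear _ _)).
by apply: eq_tensor_lift => x y; rewrite scalerA.
Qed.

Lemma scale_conv f g h (v : H) :
  (f * g) h *: v = [sw x, y <- h => (f x * g y) *: v].
Proof.
by rewrite convE (tensor_lift_comp (scalel_linear H v) (conv_bilinear f g)).
Qed.

Lemma linear_dual_act (L : H -> H) f h : linear L ->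
  L (dual_act f h) = [sw x, y <- h => f y *: L x].
Proof.
move=> Ll; rewrite (tensor_lift_comp Ll (scaler_bilinear _ _)).
by apply: eq_tensor_lift => x y; rewrite (GRing.scalable_linear Ll).
Qed.

Lemma linear_dual_op (V : lmodType k) (L : H -> V) chi h : linear L ->
  L (dual_op chi h) = [sw x, y <- h => chi x *: L y].
Proof.
move=> Ll; rewrite (tensor_lift_comp Ll (scalel_bilinear _ _)).
by apply: eq_tensor_lift => x y; rewrite (GRing.scalable_linear Ll).
Qed.

(** Both sides are $h_1f(h_2)g(h_3)$. *)
Lemma dual_actM f g h : dual_act (f * g) h = dual_act f (dual_act g h).
Proof.
rewrite (linear_dual_act _ _ _ (dual_act_linear f)).
under [RHS]eq_tensor_lift => x y do rewrite scale_dual_act.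
under [LHS]eq_tensor_lift => x y do rewrite scale_conv.
rewrite -(sweedlerA _ _ _ (fun x y z => (f y * g z) *: x)).
- by apply: eq_tensor_lift => t z; apply: eq_tensor_lift => x y; rewrite mulrC.
- move=> x; split=> [z c y y'|y c z z'] /=; rewrite scalarP.
    by rewrite mulrDl scalerDl scalerA mulrA.
  by rewrite mulrDr scalerDl scalerA mulrCA.
- by move=> y z; exact: scale_linear.
Qed.

(** Both sides are $\psi(h_1)\chi(h_2)h_3$; evaluating on the left leg is what reverses the order of
    the factors. *)
Lemma dual_opM psi chi h : dual_op (psi * chi) h = dual_op chi (dual_op psi h).
Proof.
rewrite (linear_dual_op _ _ _ _ (dual_op_linear chi)).
under [RHS]eq_tensor_lift => x y do rewrite scale_dual_op.
under [LHS]eq_tensor_lift => x y do rewrite scale_conv.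
apply: (sweedlerA _ _ _ (fun x y z => (psi x * chi y) *: z)) => [x|y z c x x'].
- split=> [z c y y'|y]; last exact: scale_linear.
  by rewrite /= scalarP mulrDr scalerDl scalerA mulrCA.
- by rewrite scalarP mulrDl scalerDl scalerA mulrA.
Qed.

(** The two operators evaluate opposite outer legs: both sides are $\chi(h_1)h_2f(h_3)$. *)
Lemma dual_op_act chi f h :
  dual_op chi (dual_act f h) = dual_act f (dual_op chi h).
Proof.
rewrite (linear_dual_op _ _ _ _ (dual_act_linear f)).
rewrite (linear_dual_act _ _ _ (dual_op_linear chi)).
under [RHS]eq_tensor_lift => x y do rewrite scale_dual_act.
under [LHS]eq_tensor_lift => x y do rewrite scale_dual_op.
rewrite -(sweedlerA _ _ _ (fun x y z => (chi x * f z) *: y)).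
- by apply: eq_tensor_lift => t z; apply: eq_tensor_lift => x y; rewrite mulrC.
- move=> x; split=> [z|y c z z'] /=; first exact: scale_linear.
  by rewrite scalarP mulrDr scalerDl scalerA mulrCA.
- by move=> y z c x x'; rewrite scalarP mulrDl scalerDl scalerA mulrA.
Qed.

Lemma counit_dual_op chi h : counit (dual_op chi h) = chi h.
Proof.
rewrite (linear_dual_op k^o _ _ _ (scalarP counit)).
(* The sum $\chi(h_1)\varepsilon(h_2)$ is by definition [(chi * 1) h], since the unit of $H^*$ is
   the counit. *)
by rewrite -{2}(mulr1 chi).
Qed.

Lemma dual_op_inj chi psi : dual_op chi =1 dual_op psi -> chi = psi.
Proof.
move=> e; apply: dualP => h.
by rewrite -(counit_dual_op chi) -(counit_dual_op psi) e.
Qed.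

Lemma dual_act_module : is_left_module (@dual_act k H).
Proof.
split=> [|h|f g h]; last exact: dual_actM; last exact: comul_counit.
split=> [h c f g|f]; last exact: dual_act_linear.
rewrite /= scale_dual_act; apply: etrans (tensor_liftD
  (scaler_bilinear H (c *: f)) (scaler_bilinear H g) (comul h)).
by apply: eq_tensor_lift => x y; exact: scalerDl.
Qed.

Lemma rota_baxter_paired_dual_op (P : {linear dual_space H -> dual_space H}) chi :
  rota_baxter_paired (@dual_act k H) (-1) P (dual_op chi) <->
  forall f h, dual_act f (dual_op (chi ^+ 2) h) = dual_act f (dual_op chi h).
Proof.
(* Commuting [dual_op chi] past the action makes the [P f] term equal to the left-hand side of the
   Rota-Baxter identity; the difference that remains does not involve [P]. *)
have E f h : dual_op chi (dual_act (P f) h) +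
    dual_op chi (dual_act f (dual_op chi h)) + -1 *: dual_op chi (dual_act f h)
  = dual_act (P f) (dual_op chi h) +
    (dual_act f (dual_op (chi ^+ 2) h) - dual_act f (dual_op chi h)).
  by rewrite !dual_op_act scaleN1r addrA dual_opM.
split=> [[_ RB] f h|RB].
  have := RB f h; rewrite E -[LHS]addr0 => /addrI /esym /eqP.
  by rewrite subr_eq0 => /eqP.
split=> [|f h]; first exact: dual_act_module.
by rewrite E RB subrr addr0.
Qed.

End DualOperators.

Theorem proposition3p4 (k : fieldType) (H : hopfType k) :
  is_left_module (@dual_act k H) /\
  forall chi : dual_space H,
    generic_rota_baxter_paired (@dual_act k H) (-1) (dual_op chi) <->
    chi ^+ 2 = chi.
Proof.
have [_ act1 _] := dual_act_module k H.
split=> [|chi]; first exact: dual_act_module.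
split=> [RB|chi2 P]; last by apply/rota_baxter_paired_dual_op; rewrite chi2.
(* The resulting condition is independent of [P], so any one operator will do; [idfun] is a
   convenient choice. *)
have /rota_baxter_paired_dual_op e := RB idfun.
apply: dual_op_inj => h.
(* Taking the unit of $H^*$ as the acting functional removes the action. *)
by have := e 1 h; rewrite !act1 => ->.
Qed.
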